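(* Let $\Phi,\Psi\in\{\Gamma,\Omega\}$ and $\star\in\{1,fin\}$. Then for a perfect space $X$ the following statements are equivalent: (1) $X$ satisfies $S_\star(\Phi,\Psi)$; (2) $(2^X,\mathbf{Z}^+)$ satisfies $S_\star(\mathcal{D}_\Phi,\mathcal{D}_\Psi)$; (3) for each $E\in 2^X$, $(2^X,\mathbf{Z}^+)$ satisfies $S_\star(\Phi_E,\Psi_E)$.
   Context: Standing assumption: all spaces are Hausdorff and non-compact unless otherwise stated. A space is perfect if every open subset is an $F_\sigma$-subset. For a space $X$, $2^X$ is the family of all closed subsets of $X$ (including $\emptyset$). For $A\subseteq X$ put $A^c=X\setminus A$ and $A^+=\{F\in 2^X: F\subseteq A\}$. The $\mathbf{Z}^+$-topology on $2^X$ has base $\{(D^c)^+: D\subseteq X \text{ non-empty finite}\}\cup\{2^X\}$. Covers are non-trivial: $\mathcal{U}$ is a cover of $X$ if $X=\bigcup\mathcal{U}$ and $X\notin\mathcal{U}$. An open cover $\mathcal{U}$ of $X$ is an $\omega$-cover if each finite subset of $X$ is contained in an element of $\mathcal{U}$; it is a $\gamma$-cover if it is infinite and for each finite $C\subseteq X$ the set $\{U\in\mathcal{U}: C\not\subseteq U\}$ is finite. $\Omega$ and $\Gamma$ are the families of all open $\omega$-covers, respectively open $\gamma$-covers, of $X$. Selection principles: $S_1(\mathcal{A},\mathcal{B})$ says that for each sequence $(A_n)_{n\in\mathbb{N}}$ of elements of $\mathcal{A}$ there are $b_n\in A_n$ ($n\in\mathbb{N}$) such that $\{b_n:n\in\mathbb{N}\}\in\mathcal{B}$.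 $S_{fin}(\mathcal{A},\mathcal{B})$ says that for each sequence $(A_n)_{n\in\mathbb{N}}$ of elements of $\mathcal{A}$ there are finite sets $B_n\subseteq A_n$ such that $\bigcup_{n\in\mathbb{N}}B_n\in\mathcal{B}$. For $(2^X,\mathbf{Z}^+)$: $\mathcal{D}_\Omega$ is the family of all dense subsets $\mathcal{A}$ of $(2^X,\mathbf{Z}^+)$ with $\emptyset\notin\mathcal{A}$. $\mathcal{D}_\Gamma$ is the family of all infinite $\mathcal{A}\subseteq 2^X$ with $\emptyset\notin\mathcal{A}$ that converge to $\{\emptyset\}$, meaning that for every $F\in 2^X$ and every $\mathbf{Z}^+$-neighborhood $W$ of $F$ the set $\{A\in\mathcal{A}: A\notin W\}$ is finite. For a point $E$ of $(2^X,\mathbf{Z}^+)$: $\Omega_E=\{\mathcal{A}\subseteq 2^X: E\in\overline{\mathcal{A}}\setminus\mathcal{A}\}$, and $\Gamma_E$ is the set of non-trivial convergent sequences to $E$, i.e. of all sets $\mathcal{A}=\{A_n:n\in\mathbb{N}\}\subseteq 2^X$ with $E\notin\mathcal{A}$ for which the sequence $(A_n)$ (repetitions allowed) converges to $E$. $\Phi_E$ denotes $\Omega_E$ if $\Phi=\Omega$ and $\Gamma_E$ if $\Phi=\Gamma$; similarly $\Psi_E$. *)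

(* Defs.v *)
From HB Require Import structures.
From mathcomp Require Import all_boot all_order.
From mathcomp Require Import all_classical topology borel_hierarchy.

Set Implicit Arguments.
Unset Strict Implicit.
Unset Printing Implicit Defensive.

Local Open Scope classical_set_scope.

(* Unrelated to the library's [perfect_set] (closed, no isolated point). *)
Definition perfect_space (X : topologicalType) : Prop :=
  forall U : set X, open U -> Fsigma U.

Inductive sel_kind := sel_one | sel_fin.

Inductive fam_kind := fam_Gamma | fam_Omega.

Definition S1 (T : Type) (A B : set (set T)) : Prop :=
  forall a : nat -> set T, (forall n, A (a n)) ->
    exists b : nat -> T, (forall n, a n (b n)) /\ B (range b).

Definition Sfin (T : Type) (A B : set (set T)) : Prop :=
  forall a : nat -> set T, (forall n, A (a n)) ->
    exists b : nat -> set T,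
      (forall n, finite_set (b n) /\ b n `<=` a n) /\ B (\bigcup_n b n).

Definition Sel (s : sel_kind) (T : Type) (A B : set (set T)) : Prop :=
  match s with sel_one => S1 A B | sel_fin => Sfin A B end.

Section Covers.
Variable X : topologicalType.

Definition open_cover (U : set (set X)) : Prop :=
  [/\ forall V, U V -> open V, \bigcup_(V in U) V = setT & ~ U setT].

Definition Omega_covers : set (set (set X)) :=
  [set U | open_cover U /\
    forall C : set X, finite_set C -> exists2 V, U V & C `<=` V].

Definition Gamma_covers : set (set (set X)) :=
  [set U | [/\ open_cover U, infinite_set U &
    forall C : set X, finite_set C ->
      finite_set [set V | U V /\ ~ (C `<=` V)]]].

Definition covers (k : fam_kind) : set (set (set X)) :=
  match k with fam_Gamma => Gamma_covers | fam_Omega => Omega_covers end.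

End Covers.

Arguments covers : clear implicits.

(* The hyperspace 2^X of all closed subsets of X, with the Z^+-topology. *)
Record zplus (X : topologicalType) := ZPlus {
  zset :> set X;
  zset_closed : closed zset }.

Section ZPlusTopology.
Variable X : topologicalType.

HB.instance Definition _ := gen_eqMixin (zplus X).
HB.instance Definition _ := gen_choiceMixin (zplus X).

(* (D^c)^+; note that zplus_basic set0 is the whole of 2^X, so that letting D
   range over all finite sets gives the base
   {(D^c)^+ : D non-empty finite} U {2^X}. *)
Definition zplus_basic (D : set X) : set (zplus X) := [set F | F `<=` ~` D].

Lemma zplus_basic_cover :
  \bigcup_(D in [set D : set X | finite_set D]) zplus_basic D = setT.
Proof.
apply/seteqP; split=> // F _; exists set0; first exact: finite_set0.
by move=> x _ [].
Qed.

Lemma zplus_basic_join (D D' : set X) (F : zplus X) :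
  finite_set D -> finite_set D' -> zplus_basic D F -> zplus_basic D' F ->
  exists D'', [/\ finite_set D'', zplus_basic D'' F &
    zplus_basic D'' `<=` zplus_basic D `&` zplus_basic D'].
Proof.
move=> fD fD' DF DF'; exists (D `|` D'); split.
- by rewrite finite_setU.
- by move=> x Fx [/(DF _ Fx)|/(DF' _ Fx)].
- by move=> G DG; split=> x /DG nD ?; apply: nD; [left|right].
Qed.

HB.instance Definition _ := isBaseTopological.Build (zplus X)
  zplus_basic_cover zplus_basic_join.

Definition zplus0 : zplus X := ZPlus (@closed0 X).

Definition D_Omega : set (set (zplus X)) :=
  [set A | dense A /\ ~ A zplus0].

Definition D_Gamma : set (set (zplus X)) :=
  [set A | [/\ infinite_set A, ~ A zplus0 &
    forall (F : zplus X) (W : set (zplus X)), nbhs F W ->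
      finite_set (A `\` W)]].

Definition D_fam (k : fam_kind) : set (set (zplus X)) :=
  match k with fam_Gamma => D_Gamma | fam_Omega => D_Omega end.

End ZPlusTopology.

Arguments D_fam : clear implicits.

Section PointFamilies.
Variables (T : topologicalType) (E : T).

Definition Omega_at : set (set T) := [set A | (closure A `\` A) E].

Definition Gamma_at : set (set T) :=
  [set A | exists a : nat -> T, [/\ A = range a, ~ A E & a @ \oo --> E]].

Definition at_fam (k : fam_kind) : set (set T) :=
  match k with fam_Gamma => Gamma_at | fam_Omega => Omega_at end.

End PointFamilies.

(* Main.v *)
(* Taking complements turns (1) into (2), and (3) at E = {} into (2); in the
   Gamma case one also uses that a countable infinite member of D_Gamma is the
   range of a sequence converging to {}.  For (2) => (3), write X \ E as an
   increasing union of closed sets K_n and fix distinct points z_0, z_1, ... of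
   X.  Replace each F in the n-th family by the sets (F `&` K_n) `|` {z_i} that
   miss z_0, ..., z_{n-1}.  The added point makes these sets non-empty even when
   F is contained in E, and forces i >= n, so that a given set can be selected
   only at finitely many stages n.  Hence a finite D disjoint from E, which lies
   in K_n for n large, is missed by F as soon as it is missed by the replacement
   of F at a late stage, and all but finitely many selections are late. *)
Require Import Defs.
From mathcomp Require Import all_boot all_order.
From mathcomp Require Import all_classical topology borel_hierarchy.

Set Implicit Arguments.
Unset Strict Implicit.
Unset Printing Implicit Defensive.

Local Open Scope classical_set_scope.

(** * Sequences, finiteness and transport of selection principles *)

Lemma infinite_set_seq (T : Type) (A : set T) : infinite_set A ->
  exists2 h : nat -> T, injective h & forall n, A (h n).
Proof.
elim/Ppointed: T => T in A *; first by rewrite emptyE => /(_ (finite_set0 _)).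
move=> /infiniteP/pcard_leP[h]; exists h => [m n|n]; last exact: funS.
by apply: inj; rewrite inE.
Qed.

Lemma infinite_countable_seq (T : Type) (A : set T) :
  countable A -> infinite_set A ->
  exists2 h : nat -> T, injective h & range h = A.
Proof.
move=> cA iA; have /card_set_bijP[f [_ finj fsurj]] := eq_card_nat cA iA.
have /choice[h hP] n : exists x, A x /\ f x = n.
  by have [x Ax fx] := fsurj n I; exists x.
exists h => [m n hmn|].
  by rewrite -(hP m).2 hmn (hP n).2.
apply/seteqP; split=> [_ [n _ <-]|x Ax]; first exact: (hP n).1.
by exists (f x) => //; apply: finj; rewrite ?inE ?(hP _).2 //; exact: (hP _).1.
Qed.

Lemma finite_nat_bound (A : set nat) : finite_set A ->
  exists N, forall n, N <= n -> ~ A n.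
Proof.
move=> /finite_fsetP[F ->]; exists (\max_(i <- finmap.enum_fset F) i).+1 => n Nn /= nF.
by move: Nn; rewrite ltnNge leq_bigmax_seq.
Qed.

Lemma finite_preimage_fibers (T U : Type) (J : set T) (f : T -> U) (B : set U) :
  finite_set B -> (forall y, B y -> finite_set (J `&` f @^-1` [set y])) ->
  finite_set (J `&` f @^-1` B).
Proof.
move=> fB ff; apply: (@sub_finite_set _ _
  (\bigcup_(y in B) (J `&` f @^-1` [set y]))); last exact: bigcup_finite.
by move=> x [Jx Bfx]; exists (f x).
Qed.

(** Select in the source families and push the selection forward along [f]. Asking for an inclusion
    instead of an equality allows the image to be a subfamily. *)
Lemma Sel_transfer (s : sel_kind) (T T' : Type) (A B : set (set T))
    (A' B' : set (set T')) (f : T -> T') :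
  (forall a', A' a' -> exists2 a, A a & f @` a `<=` a') ->
  (forall b, B b -> B' (f @` b)) -> Sel s A B -> Sel s A' B'.
Proof.
move=> AA' BB'; case: s => /= SAB a' A'a';
  have /choice[a aP] n : exists a, A a /\ f @` a `<=` a' n
    by have [a] := AA' _ (A'a' n); exists a.
- have [b [ab Bb]] := SAB a (fun n => (aP n).1).
  exists (f \o b); split=> [n|]; first by apply: (aP n).2; exists (b n).
  by rewrite -(image_comp b f); exact: BB'.
- have [b [ab Bb]] := SAB a (fun n => (aP n).1).
  exists (fun n => f @` b n); split=> [n|].
    split; first by apply: finite_image; case: (ab n).
    by move=> _ [x bx <-]; apply: (aP n).2; exists x => //; apply: (ab n).2.
  by rewrite -image_bigcup; exact: BB'.
Qed.

(** * The topology and its families in terms of finite sets *)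

Section ZPlusTheory.
Variable X : topologicalType.
Implicit Types (A : set (zplus X)) (D : set X) (E F G : zplus X).

Lemma zset_inj : injective (@zset X).
Proof.
by case=> F cF [G cG] /= FG; subst G; congr ZPlus; exact: Prop_irrelevance.
Qed.

Lemma nbhs_zplusP F (W : set (zplus X)) : nbhs F W <->
  exists D, [/\ finite_set D, zplus_basic D F & zplus_basic D `<=` W].
Proof.
rewrite nbhsE; split=> [[B [[Ds DsD <-] [D DsF FD]] BW]|[D [fD FD DW]]].
  exists D; split=> //; first exact: DsD.
  by move=> G GD; apply: BW; exists D.
exists (zplus_basic D) => //; split=> //.
by exists [set D]; [move=> _ ->|rewrite bigcup_set1].
Qed.

Lemma closure_zplusP A E : closure A E <->
  forall D, finite_set D -> zplus_basic D E -> exists2 F, A F & zplus_basic D F.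
Proof.
split=> [cA D fD DE|cA W /nbhs_zplusP[D [fD DE DW]]].
  have /cA[F [AF DF]] : nbhs E (zplus_basic D) by apply/nbhs_zplusP; exists D; split.
  by exists F.
by have [F AF DF] := cA D fD DE; exists F; split=> //; exact: DW.
Qed.

Lemma cvg_zplusP (a : nat -> zplus X) E : a @ \oo --> E <->
  forall D, finite_set D -> zplus_basic D E ->
    finite_set [set n | ~ zplus_basic D (a n)].
Proof.
split=> [aE D fD DE|aE W /nbhs_zplusP[D [fD DE DW]]].
  have /aE[N _ aN] : nbhs E (zplus_basic D) by apply/nbhs_zplusP; exists D; split.
  apply: (sub_finite_set _ (finite_II N)) => n /= nD.
  by rewrite ltnNge; apply/negP => /aN.
have [N NP] := finite_nat_bound (aE D fD DE).
by exists N => // n /NP /contrapT /DW.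
Qed.

Lemma zplus_basic_zplus0 D : zplus_basic D (zplus0 X).
Proof. by []. Qed.

Lemma zplus_neq0P F : F <> zplus0 X <-> exists x, zset F x.
Proof.
split=> [F0|[x Fx] F0]; last by rewrite F0 in Fx.
by apply/set0P/eqP => F0'; apply: F0; exact: zset_inj.
Qed.

(** Every non-empty open set contains a basic one and every basic set contains {}, so density says
    that {} lies in the closure. *)
Lemma D_OmegaP A : D_Omega A <->
  ~ A (zplus0 X) /\
  forall D, finite_set D -> exists2 F, A F & zplus_basic D F.
Proof.
split=> [[dA A0]|[A0 dA]].
  split=> // D fD; have : closure A (zplus0 X).
    by move=> W; rewrite nbhsE => -[B [oB B0] BW]; have [F [BF AF]] :=
      dA B (ex_intro _ _ B0) oB; exists F; split=> //; exact: BW.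
  by move=> /closure_zplusP; apply.
split=> // O [G OG] oO.
have /nbhs_zplusP[D [fD DG DO]] : nbhs G O by exact: open_nbhs_nbhs.
by have [F AF DF] := dA D fD; exists F; split=> //; exact: DO.
Qed.

(** A basic neighbourhood of any [F] is also one of {}, so convergence can be tested at {} alone. *)
Lemma D_GammaP A : D_Gamma A <->
  [/\ infinite_set A, ~ A (zplus0 X) &
    forall D, finite_set D -> finite_set (A `\` zplus_basic D)].
Proof.
split=> [[iA A0 gA]|[iA A0 gA]]; split=> //.
  move=> D fD; apply: (gA (zplus0 X)); apply/nbhs_zplusP.
  by exists D; split.
move=> F W /nbhs_zplusP[D [fD _ DW]].
by apply: sub_finite_set (gA D fD); exact: setDS.
Qed.

(** Infinitude comes from finite fibres: if x lies in [g m], then no [n] with [g n = g m] gives a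
    set missing {x}. A cofinite [Q] lets finitely many terms be dropped. *)
Lemma D_Gamma_image (Q : set nat) (g : nat -> zplus X) :
  finite_set (~` Q) -> (forall n, Q n -> g n <> zplus0 X) ->
  (forall D, finite_set D ->
    finite_set [set n | Q n /\ ~ zplus_basic D (g n)]) ->
  D_Gamma (g @` Q).
Proof.
move=> cQ g0 gD; apply/D_GammaP; split=> [fgQ|[n Qn /(g0 n Qn)]|D fD] //.
  apply: infinite_nat; rewrite -(setUv Q) finite_setU; split=> //.
  apply: (@sub_finite_set _ _ (Q `&` g @^-1` (g @` Q))).
    by move=> n Qn; split=> //; exists n.
  apply: finite_preimage_fibers => // _ [m Qm <-].
  have /zplus_neq0P[x gmx] := g0 m Qm.
  apply: sub_finite_set (gD [set x] (finite_set1 x)) => n [Qn /= gnm].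
  by split=> // /(_ x); rewrite /setC /= gnm => /(_ gmx).
apply: sub_finite_set (finite_image g (gD D fD)).
by move=> _ [[n Qn <-] nD]; exists n.
Qed.

(** * Complements: covers and families of closed sets *)

(** [F] misses [D] exactly when [D] lies in the complement of [F], and {} corresponds to X. *)
Lemma D_famE k A : D_fam X k A <->
  covers X k ((fun F => ~` zset F) @` A).
Proof.
have subC F D : zplus_basic D F <-> D `<=` ~` F.
  by split=> FD x xF /FD.
have nontriv : ~ [set ~` zset F | F in A] setT <-> ~ A (zplus0 X).
  split=> nA => [A0|[F AF FT]]; apply: nA.
    by exists (zplus0 X) => //=; rewrite setC0.
  suff <- : F = zplus0 X by [].
  by apply: zset_inj; rewrite -[LHS]setCK FT setCT.
have opC V : [set ~` zset F | F in A] V -> open V.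
  by case=> F AF <-; apply: closed_openC; exact: zset_closed.
have Cinj : injective (fun F : zplus X => ~` zset F).
  by move=> F G /setC_inj/zset_inj.
case: k => /=.
  rewrite D_GammaP; split=> [[iA A0 gA]|[[_ _ A0] iA gA]].
    have iC : infinite_set [set ~` zset F | F in A].
      move=> fCA; apply: iA.
      apply: sub_finite_set (finite_preimage (in2W Cinj) fCA).
      by move=> F AF; exists F.
    have gC C : finite_set C ->
      finite_set [set V | [set ~` zset F | F in A] V /\ ~ C `<=` V].
      move=> fC; apply: sub_finite_set (finite_image (fun F => ~` zset F) (gA C fC)).
      by move=> _ [[F AF <-] CF]; exists F => //; split=> // /subC.
    split=> //; split=> //; last exact/nontriv.
    apply/seteqP; split=> // x _.
    (* Infinitely many members, of which only finitely many omit x. *)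
    have [V [CV xV]] := infinite_setN0 (infinite_setD iC (gC _ (finite_set1 x))).
    exists V => //; apply: contrapT => Vx; apply: xV; split=> //.
    by move=> /(_ x erefl).
  split; [|exact/nontriv|] => [fA|D fD].
    by apply: iA; exact: finite_image.
  apply: sub_finite_set (finite_preimage (in2W Cinj) (gA D fD)).
  by move=> F [AF DF]; split; [exists F|move=> /subC].
rewrite D_OmegaP; split=> [[A0 dA]|[[_ _ A0] oA]].
  split; last by move=> C /dA[F AF CF]; exists (~` F); [exists F|exact/subC].
  split=> //; last exact/nontriv.
  apply/seteqP; split=> // x _; have [F AF xF] := dA _ (finite_set1 x).
  by exists (~` F); [exists F|move=> /xF; exact].
split; first exact/nontriv.
by move=> D /oA[_ [F AF <-] DF]; exists F => //; exact/subC.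
Qed.

Lemma Sel_covers_D_fam (s : sel_kind) (Phi Psi : fam_kind) :
  Sel s (covers X Phi) (covers X Psi) <->
  Sel s (D_fam X Phi) (D_fam X Psi).
Proof.
pose c F := ~` zset F.
(* The closure makes [d] total; on open sets it changes nothing, and [d] inverts [c]. *)
pose d (V : set X) : zplus X := ZPlus (@closed_closure _ (~` V)).
have dK V : open V -> c (d V) = V.
  move=> oV; rewrite /c /= -(closure_id _).1 ?setCK //.
  exact: open_closedC.
have oC F : open (c F) by apply: closed_openC; exact: zset_closed.
have cK F : d (c F) = F.
  by apply: zset_inj; apply: setC_inj; exact: dK.
have cov_open k U V : covers X k U -> U V -> open V.
  by case: k => /= [[[oU _ _] _ _]|[[oU _ _] _]]; exact: oU.
split.
  apply: (@Sel_transfer _ _ _ _ _ _ _ d) => [A /D_famE cA|b cb].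
    by exists (c @` A) => // _ [_ [F AF <-] <-]; rewrite cK.
  apply/D_famE; rewrite image_comp; suff -> : (c \o d) @` b = b by [].
  apply/seteqP; split=> [_ [V bV <-]|V bV].
    by rewrite /= dK //; exact: cov_open cb bV.
  by exists V => //=; rewrite dK //; exact: cov_open cb bV.
apply: (@Sel_transfer _ _ _ _ _ _ _ c) => [U cU|b /D_famE //].
exists (c @^-1` U); last by move=> _ [F UF <-].
apply/D_famE; suff -> : [set ~` zset F | F in c @^-1` U] = U by [].
apply/seteqP; split=> [_ [F cF <-] //|V UV].
have oV := cov_open _ _ _ cU UV.
by exists (d V); [rewrite /preimage /= dK|exact: dK].
Qed.


(** * Selection at the point {} *)

Lemma at_fam_zplus0 k A : at_fam (zplus0 X) k A -> D_fam X k A.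
Proof.
case: k => /= [[a [-> a0 /cvg_zplusP acvg]]|[/closure_zplusP cA A0]].
  apply: D_Gamma_image => [|n _ an0|D fD]; first by rewrite setCT.
    by apply: a0; rewrite -an0; exists n.
  by apply: sub_finite_set (acvg D fD (@zplus_basic_zplus0 D)) => n [].
by apply/D_OmegaP; split=> // D fD; exact: cA.
Qed.

(** A member of [D_Gamma] may be uncountable, so it is thinned out to the range of an injective
    sequence. *)
Lemma D_fam_sub_at k A : D_fam X k A ->
  exists2 A', at_fam (zplus0 X) k A' & A' `<=` A.
Proof.
case: k => /= [/D_GammaP[iA A0 gA]|/D_OmegaP[A0 dA]]; last first.
  exists A => //; split=> //.
  by apply/closure_zplusP => D fD _; exact: dA.
have [a ainj aA] := infinite_set_seq iA.
have raA : range a `<=` A by move=> _ [n _ <-].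
exists (range a) => //; exists a; split=> // [/raA //|].
apply/cvg_zplusP => D fD _.
apply: sub_finite_set (finite_preimage (in2W ainj) (gA D fD)) => n nD.
by split=> //; exact: aA.
Qed.

Lemma Sel_at_zplus0 (s : sel_kind) (Phi Psi : fam_kind) :
  Sel s (at_fam (zplus0 X) Phi) (at_fam (zplus0 X) Psi) ->
  Sel s (D_fam X Phi) (D_fam X Psi).
Proof.
apply: (@Sel_transfer _ _ _ _ _ _ _ id) => [A /D_fam_sub_at[A' ? ?]|b].
  by exists A' => //; rewrite image_id.
by rewrite image_id; exact: at_fam_zplus0.
Qed.

(** * Pointed traces and their sources *)

Section Traces.
Variables (E : zplus X) (z : nat -> X).
Hypotheses (hX : hausdorff_space X) (zinj : injective z).

(* In terms of the complements U = X \ F and V = X \ G this says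
   V = (U `|` ~` K) `\ z i. *)
Definition pointed_trace (K : set X) (i : nat) F G :=
  zset G = (F `&` K) `|` [set z i].

Lemma pointed_trace_exists K i F : closed K -> exists G, pointed_trace K i F G.
Proof.
move=> cK; have cG : closed ((F `&` K) `|` [set z i]).
  apply: closedU; first by apply: closedI => //; exact: zset_closed.
  exact/accessible_closed_set1/hausdorff_accessible.
by exists (ZPlus cG).
Qed.

(** [D] constrains [F] only inside [K]; once [D] lies in [K], missing [D] passes from [G] back to
    [F]. *)
Lemma pointed_trace_basic K i F G D : pointed_trace K i F G ->
  zplus_basic D G <-> zplus_basic (D `&` K) F /\ ~ D (z i).
Proof.
move=> FG; rewrite /zplus_basic /= FG; split=> [GD|[FDK Dz] x].
  split=> [x Fx [Dx Kx]|]; first by apply: (GD x) => //; left.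
  by apply: GD; right.
by move=> [[Fx Kx] Dx|-> //]; exact: (FDK x).
Qed.

Lemma pointed_trace_neq0 K i F G : pointed_trace K i F G -> G <> zplus0 X.
Proof. by move=> FG; apply/zplus_neq0P; exists (z i); rewrite FG; right. Qed.

Lemma zplus_basic_setI K D : K `<=` ~` E -> zplus_basic (D `&` K) E.
Proof. by move=> KE x Ex [_ /KE]. Qed.

Lemma finite_zinj D : finite_set D -> finite_set (z @^-1` D).
Proof. by apply: finite_preimage; exact: in2W. Qed.

(** Finite subsets of [K] are disjoint from E, so the hypothesis on [A] applies to them; injectivity
    of [z] keeps the added point off any finite set for large indices. *)
Lemma trace_family (Phi : fam_kind) A (K P : set X) :
  at_fam E Phi A -> closed K -> K `<=` ~` E -> finite_set P ->
  exists2 A', D_fam X Phi A' & forall G, A' G ->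
    exists F i, [/\ A F, pointed_trace K i F G & zplus_basic P G].
Proof.
move=> + cK KE fP; case: Phi => /= [[a [-> aE /cvg_zplusP acvg]]|].
  have /choice[g gP] n := pointed_trace_exists n (a n) cK.
  have fg D : finite_set D -> finite_set [set n | ~ zplus_basic D (g n)].
    move=> fD; apply: (@sub_finite_set _ _
        ([set n | ~ zplus_basic (D `&` K) (a n)] `|` z @^-1` D)).
      move=> n /= nD; have [Dz|nDz] := pselect (D (z n)); first by right.
      by left=> aD; apply: nD; apply/(pointed_trace_basic _ (gP n)).
    rewrite finite_setU; split; last exact: finite_zinj.
    by apply: acvg; [exact: finite_setIl|exact: zplus_basic_setI].
  (* Asking to miss [P] discards only finitely many indices. *)
  exists (g @` [set n | zplus_basic P (g n)]).
    apply: D_Gamma_image => [|n _|D fD].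
    - exact: fg.
    - exact: pointed_trace_neq0 (gP n).
    - by apply: sub_finite_set (fg D fD) => n [].
  by move=> _ [n Pn <-]; exists (a n), n; split=> //; exists n.
move=> [/closure_zplusP cA _].
exists [set G | exists F i, [/\ A F, pointed_trace K i F G & zplus_basic P G]].
  apply/D_OmegaP; split=> [[F [i [_ /pointed_trace_neq0 ]]] //|D fD].
  have fDP : finite_set (D `|` P) by rewrite finite_setU.
  have [F AF FDP] := cA _ (finite_setIl K fDP) (zplus_basic_setI KE).
  have [i Di] := finite_nat_bound (finite_zinj fDP).
  have [G FG] := pointed_trace_exists i F cK.
  have GDP : zplus_basic (D `|` P) G.
    by apply/(pointed_trace_basic _ FG); split=> //; exact: Di.
  exists G; last by move=> x /GDP nDP Dx; apply: nDP; left.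
  by exists F, i; split=> // x /GDP nDP Px; apply: nDP; right.
by move=> G [F [i ?]]; exists F, i.
Qed.

(** [J] holds the selected pairs (stage, trace) and [g] returns the source. The stage is recorded
    because one trace may be selected at several stages with different sources. *)
Lemma at_fam_of_traces (Psi : fam_kind) (K : nat -> set X)
    (J : set (nat * zplus X)) (g : nat * zplus X -> zplus X)
    (i : nat * zplus X -> nat) :
  (forall D, finite_set D -> zplus_basic D E ->
    exists m, forall n, m <= n -> D `<=` K n) ->
  (forall n, finite_set [set G | J (n, G)]) ->
  (forall p, J p -> [/\ g p <> E, pointed_trace (K p.1) (i p) (g p) p.2 &
    zplus_basic (z @` `I_p.1) p.2]) ->
  D_fam X Psi (snd @` J) -> at_fam E Psi (g @` J).
Proof.
move=> KE fJ JP DJ.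
have gE : ~ (g @` J) E by move=> [p /JP[gpE _ _] /gpE].
have Jlt m : finite_set [set p | J p /\ p.1 < m].
  apply: (@sub_finite_set _ _
      (\bigcup_(n in `I_m) (pair n @` [set G | J (n, G)]))).
    by move=> [n G] /= [JnG nm]; exists n => //; exists G.
  by apply: bigcup_finite => [|n _]; [exact: finite_II|exact: finite_image].
have gJ p D m : J p -> m <= p.1 -> (forall n, m <= n -> D `<=` K n) ->
    zplus_basic D p.2 -> zplus_basic D (g p).
  move=> Jp mp DK pD x gx Dx; have [_ tr _] := JP p Jp.
  have [gD _] := (pointed_trace_basic D tr).1 pD.
  by apply: (gD x gx); split=> //; exact: DK Dx.
case: Psi DJ => /= [/D_GammaP[iJ _ gamJ]|/D_OmegaP[J0 omJ]]; last first.
  split=> //; apply/closure_zplusP => D fD DE; have [m DK] := KE D fD DE.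
  (* Also asking to miss a point of each early selection forces a late one. *)
  have fD' : finite_set (D `|` (z \o i) @` [set p | J p /\ p.1 < m]).
    by rewrite finite_setU; split=> //; exact: finite_image.
  have [_ [p Jp <-] pD'] := omJ _ fD'.
  have mp : m <= p.1.
    rewrite leqNgt; apply/negP => pm; apply: (pD' (z (i p))).
      by have [_ -> _] := JP p Jp; right.
    by right; exists p.
  exists (g p); first by exists p.
  by apply: gJ DK _ => // x /pD' nD Dx; apply: nD; left.
(* Such p misses z_0, ..., z_{p.1 - 1}, while G contains some z_i: p.1 <= i. *)
have fibJ G : finite_set (J `&` snd @^-1` [set G]).
  have [[p [Jp pG]]|nJ] := pselect (J `&` snd @^-1` [set G] !=set0); last first.
    by apply: sub_finite_set (finite_set0 _) => p Jp; apply: nJ; exists p.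
  apply: sub_finite_set (Jlt (i p).+1) => q [Jq qG]; split=> //.
  rewrite ltnS leqNgt; apply/negP => iq.
  have [_ _ /(_ (z (i p)))] := JP q Jq; apply; last by exists (i p).
  by rewrite qG -pG; have [_ -> _] := JP p Jp; right.
have infJ : infinite_set J by move=> /(finite_image snd).
have cJ : countable J.
  apply: (@sub_countable _ _ J (\bigcup_n (pair n @` [set G | J (n, G)]))).
    by apply: subset_card_le => -[n G] JnG; exists n => //; exists G.
  apply: bigcup_countable => // n _.
  by apply: finite_set_countable; exact: finite_image.
have [h hinj hJ] := infinite_countable_seq cJ infJ.
exists (g \o h); split=> //; first by rewrite -hJ image_comp.
apply/cvg_zplusP => D fD DE; have [m DK] := KE D fD DE.
(* A term can fail to miss [D] only if its stage is early or its trace fails to miss [D]. *)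
apply: (@sub_finite_set _ _ (h @^-1` ([set p | J p /\ p.1 < m] `|`
    (J `&` snd @^-1` ((snd @` J) `\` zplus_basic D))))).
  move=> n /= nD; have Jhn : J (h n) by rewrite -hJ; exists n.
  have [hm|hm] := ltnP (h n).1 m; [by left|right].
  by do ![split=> //]; [exists (h n)|move=> hnD; apply: nD; exact: gJ DK _].
apply: finite_preimage (in2W hinj) _; rewrite finite_setU; split=> //.
by apply: finite_preimage_fibers => //; exact: gamJ.
Qed.

End Traces.

(** * From {} to an arbitrary point *)

(** [Sel_transfer] does not suffice: the replacement depends on the stage, through [K n] and the
    points to be missed. *)
Lemma Sel_at_fam (s : sel_kind) (Phi Psi : fam_kind) E :
  hausdorff_space X -> infinite_set [set: X] -> Fsigma (~` E) ->
  Sel s (D_fam X Phi) (D_fam X Psi) ->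
  Sel s (at_fam E Phi) (at_fam E Psi).
Proof.
move=> hX iX [F cF EF] SD.
have [z zinj _] := infinite_set_seq iX.
pose K n := \bigcup_(j in `I_n) F j.
have cK n : closed (K n) by apply: closed_bigcup => // j _; exact: cF.
have KE n : K n `<=` ~` E by rewrite EF => x [j _ Fjx]; exists j.
have KD D : finite_set D -> zplus_basic D E ->
    exists m, forall n, m <= n -> D `<=` K n.
  move=> fD DE.
  (* The pieces [F j] that meet the finite set [D] at its points have bounded indices; the bound is
     the required stage. *)
  have /choice[j jP] x : exists j, D x -> F j x.
    have [Dx|] := pselect (D x); last by exists 0.
    have : (~` E) x by move=> /DE.
    by rewrite EF => -[j _ Fjx]; exists j.
  have [m mP] := finite_nat_bound (finite_image j fD).
  exists m => n mn x Dx; exists (j x); last exact: jP.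
  rewrite /= ltnNge; apply/negP => nj.
  by apply: (mP (j x)); [exact: leq_trans nj|exists x].
have famE A G : at_fam E Phi A -> A G -> G <> E.
  by case: Phi {SD} => /= [[a [_ AE _]]|[_ AE]] AG GE; apply: AE; rewrite -GE.
have refine (a : nat -> set (zplus X)) : (forall n, at_fam E Phi (a n)) ->
    exists2 a', (forall n, D_fam X Phi (a' n)) & exists g i,
      forall p, a' p.1 p.2 -> [/\ a p.1 (g p),
        pointed_trace z (K p.1) (i p) (g p) p.2 & zplus_basic (z @` `I_p.1) p.2].
  move=> aE.
  have /choice[a' a'P] n : exists a', D_fam X Phi a' /\ forall G, a' G ->
      exists H i, [/\ a n H, pointed_trace z (K n) i H G &
        zplus_basic (z @` `I_n) G].
    have fP : finite_set (z @` `I_n) by apply/finite_image/finite_II.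
    by have [a'] := trace_family hX zinj (aE n) (cK n) (KE n) fP; exists a'.
  exists a' => [n|]; first exact: (a'P n).1.
  (* Sources and point indices are chosen for all pairs at once; {} and 0 are dummy values off the
     families. *)
  have /choice[gi giP] (p : nat * zplus X) : exists gi : zplus X * nat,
      a' p.1 p.2 -> [/\ a p.1 gi.1, pointed_trace z (K p.1) gi.2 gi.1 p.2 &
        zplus_basic (z @` `I_p.1) p.2].
    have [/(a'P p.1).2[H [i HP]]|] := pselect (a' p.1 p.2).
      by exists (H, i).
    by exists (zplus0 X, 0).
  by exists (fst \o gi), (snd \o gi).
case: s SD => /= SD a aE; have [a' a'D [g [i giP]]] := refine a aE.
- have [b [ba Db]] := SD a' a'D.
  exists (fun n => g (n, b n)); split=> [n|]; first by have [] := giP (n, b n) (ba n).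
  (* [J] is here the graph of [b], with one trace per stage. *)
  have -> : range (fun n => g (n, b n)) = g @` range (fun n => (n, b n)).
    by rewrite image_comp.
  apply: (at_fam_of_traces (z := z) (i := i) KD).
  + move=> n; apply: sub_finite_set (finite_set1 (b n)).
    by move=> G [_ _ [-> ->]].
  + move=> _ [n _ <-]; have [agn tr bas] := giP (n, b n) (ba n).
    by split=> //; exact: famE agn.
  + by rewrite image_comp.
- have [b [ba Db]] := SD a' a'D.
  exists (fun n => (fun G => g (n, G)) @` b n); split=> [n|].
    split; first by apply: finite_image; case: (ba n).
    by move=> _ [G bG <-]; have [] := giP (n, G) ((ba n).2 _ bG).
  pose J := [set p : nat * zplus X | b p.1 p.2].
  have -> : \bigcup_n ((fun G => g (n, G)) @` b n) = g @` J.
    apply/seteqP; split=> [_ [n _ [G bG <-]]|_ [[n G] bG <-]].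
      by exists (n, G).
    by exists n => //; exists G.
  apply: (at_fam_of_traces (z := z) (i := i) KD).
  + by move=> n; case: (ba n).
  + move=> p Jp; have [agp tr bas] := giP p ((ba p.1).2 _ Jp).
    by split=> //; exact: famE agp.
  + suff -> : snd @` J = \bigcup_n b n by [].
    apply/seteqP; split=> [_ [[n G] bG <-]|G [n _ bG]]; first by exists n.
    by exists (n, G).
Qed.

End ZPlusTheory.

Theorem theorem3p9 (X : topologicalType)
    (hX : hausdorff_space X) (ncX : ~ compact [set: X])
    (pX : perfect_space X) (Phi Psi : fam_kind) (star : sel_kind) :
  (Sel star (covers X Phi) (covers X Psi) <->
   Sel star (D_fam X Phi) (D_fam X Psi)) /\
  (Sel star (D_fam X Phi) (D_fam X Psi) <->
   forall E : zplus X, Sel star (at_fam E Phi) (at_fam E Psi)).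
Proof.
split; first exact: Sel_covers_D_fam.
split=> [SD E|SE]; last exact: Sel_at_zplus0 (SE _).
(* Finite spaces are compact, so X is infinite. *)
apply: Sel_at_fam SD => //; first by move=> /finite_compact.
by apply/pX/closed_openC/zset_closed.
Qed.
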